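(* Let $n\ge2$ be an integer. If $n$ is even, then $C(n,90^\circ)\le n/2$. If $n$ is odd, then $C(n,90^\circ)\le (n+1)/2$.
   Context: A set $A\subset\mathbb{R}^n$ contains the angle $\alpha\in[0,180^\circ]$ if there exist distinct points $x,y,z\in A$ such that the angle between the vectors $y-x$ and $z-x$ is $\alpha$. Let $\dim$ denote Hausdorff dimension. For an integer $n\ge2$ and $\alpha\in[0,180^\circ]$ define $$C(n,\alpha)=\sup\{s : \text{there is a compact } A\subset\mathbb{R}^n \text{ with } \dim(A)=s \text{ such that } A \text{ does not contain the angle } \alpha\}.$$ *)

(* Defs.v *)
From HB Require Import structures.
From mathcomp Require Import all_boot all_order all_algebra.
From mathcomp Require Import all_classical all_reals all_analysis.

Set Implicit Arguments.
Unset Strict Implicit.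
Unset Printing Implicit Defensive.

Import Order.TTheory GRing.Theory Num.Theory.
Import numFieldNormedType.Exports.

Local Open Scope classical_set_scope.
Local Open Scope ring_scope.

(* The library norm [`|x|] on ['rV[R]_n] is the sup norm, so the Euclidean
   inner product and norm are introduced here. Both norms induce the library's
   (product) topology on ['rV[R]_n], which is the one [compact] refers to. *)
Definition dotp (R : realType) (n : nat) (u v : 'rV[R]_n) : R :=
  \sum_(i < n) u ord0 i * v ord0 i.

Definition enorm (R : realType) (n : nat) (u : 'rV[R]_n) : R :=
  Num.sqrt (dotp u u).

(* In radians, with values in [0, pi] for nonzero u and v. *)
Definition vangle (R : realType) (n : nat) (u v : 'rV[R]_n) : R :=
  acos (dotp u v / (enorm u * enorm v)).

Definition contains_angle (R : realType) (n : nat) (A : set 'rV[R]_n)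
    (alpha : R) : Prop :=
  exists x y z : 'rV[R]_n,
    [/\ A x, A y & A z] /\ [/\ x <> y, x <> z & y <> z] /\
    vangle (y - x) (z - x) = alpha.

(* Equal to [-oo] on [set0] and to [+oo] on unbounded sets. *)
Definition ediam (R : realType) (n : nat) (U : set 'rV[R]_n) : \bar R :=
  ereal_sup [set d : \bar R |
    exists x y : 'rV[R]_n, [/\ U x, U y & d = (enorm (x - y))%:E]].

(* Empty members of a cover contribute nothing, so finite covers are allowed;
   a nonempty set contributes 1 when s = 0, since [poweR x 0 = 1]. *)
Definition hausdorff_premeasure (R : realType) (n : nat) (s delta : R)
    (A : set 'rV[R]_n) : \bar R :=
  ereal_inf [set m : \bar R | exists U : nat -> set 'rV[R]_n,
    [/\ A `<=` \bigcup_i U i,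
        forall i, (ediam (U i) <= delta%:E)%E &
        m = (\sum_(i <oo | `[< U i !=set0 >]) poweR (ediam (U i)) s)%E]].

Definition hausdorff_measure (R : realType) (n : nat) (s : R)
    (A : set 'rV[R]_n) : \bar R :=
  ereal_sup [set m : \bar R | exists2 delta : R,
    0 < delta & m = hausdorff_premeasure s delta A].

Definition hausdorff_dim (R : realType) (n : nat) (A : set 'rV[R]_n) : \bar R :=
  ereal_inf [set e : \bar R | exists s : R,
    [/\ 0 <= s, hausdorff_measure s A = 0%E & e = s%:E]].

Definition Cangle (R : realType) (n : nat) (alpha : R) : \bar R :=
  ereal_sup [set s : \bar R | exists A : set 'rV[R]_n,
    [/\ compact A, hausdorff_dim A = s & ~ contains_angle A alpha]].

(* Main.v *)
Require Import Defs.
From mathcomp Require Import all_boot all_order all_algebra.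
From mathcomp Require Import all_classical all_reals all_analysis.
From mathcomp Require Import ring lra.

Set Implicit Arguments.
Unset Strict Implicit.
Unset Printing Implicit Defensive.

Import Order.TTheory GRing.Theory Num.Theory.
Import numFieldNormedType.Exports.

Local Open Scope classical_set_scope.
Local Open Scope ring_scope.

(* It suffices to show, for n <= 2m and s > m, that a compact A in R^n without a
   right angle has H^s(A) = 0.  Otherwise, for every large N there is a finitely
   supported weight w on A, of total mass bounded below, whose balls of radius
   2^-j have mass at most 2^-js for all j <= N (a discrete Frostman lemma).
   Pad R^n to R^m x R^m.  For an m x m matrix g with entries in [0, 1], the m-planes
   V_g = {b = g a} and {a = - g^T b} are orthogonal, so by compactness, given k,
   for N large, for each x in A and each g, one of the two planes
   through x has its 2^-N-neighbourhood meeting A only within 2^-k of x.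
   Cauchy-Schwarz in the m-dimensional projections shows that the total w x w mass
   of pairs in such narrow slabs is at least a constant times 2^-Nm.  Averaged over
   a fine grid of matrices g, a pair at distance d shares a slab with probability
   O((2^-N / d)^m), so the mass is at most O(2^-Nm 2^-k(s-m)).  Letting k grow gives
   a contradiction. *)

(** * Finite combinatorics: saturation, Vitali selection, Cauchy-Schwarz *)

(** Greedy: each point in turn receives the least slack among the constraints through it. That
    constraint becomes tight, none is violated, and a tight one stays tight because any later point
    in it has least slack 0. *)
Lemma saturated_weights (R : realFieldType) (T J : finType) (S : J -> pred T)
    (b : J -> R) :
  (forall j, 0 <= b j) -> (forall t, exists j, S j t) ->
  exists w : T -> R, [/\ forall t, 0 <= w t,
    forall j, \sum_(t | S j t) w t <= b j &
    forall t, exists2 j, S j t & \sum_(u | S j u) w u = b j].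
Proof.
move=> b0 cov.
suff /(_ (enum T)) [w [w0 wb ws]] : forall s : seq T,
    exists w : T -> R, [/\ forall t, 0 <= w t,
      forall j, \sum_(t | S j t) w t <= b j &
      forall t, t \in s -> exists2 j, S j t & \sum_(u | S j u) w u = b j].
  by exists w; split=> // t; apply: ws; rewrite mem_enum.
elim=> [|t s [w [w0 wb ws]]].
  by exists (fun=> 0); split=> // j; rewrite big1.
have [j0 tj0] := cov t.
pose slack j := b j - \sum_(u | S j u) w u.
have [j1 tj1 minj1] := @Order.TotalTheory.arg_minP _ _ _ j0 (fun j => S j t) slack tj0.
have slack0 j : 0 <= slack j by rewrite subr_ge0.
have sumE j : \sum_(u | S j u) (w u + (u == t)%:R * slack j1) =
    \sum_(u | S j u) w u + (S j t)%:R * slack j1.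
  rewrite big_split /= -mulr_suml; congr (_ + _ * _).
  case: (boolP (S j t)) => [Sjt|nSjt].
    rewrite (bigD1 t) //= eqxx big1 ?addr0 // => u /andP[_ /negbTE ->] //.
  rewrite big1 // => u Su; case: eqP => // ut; by rewrite ut (negbTE nSjt) in Su.
exists (fun u => w u + (u == t)%:R * slack j1); split=> [u|j|u].
- by rewrite addr_ge0 // mulr_ge0.
- rewrite sumE; case: (boolP (S j t)) => [/minj1|_]; rewrite ?mul0r ?addr0 //.
  by rewrite mul1r {2}/slack lerBrDl.
- rewrite inE; case: (eqVneq u t) => [->|_] /= us.
    by exists j1 => //; rewrite sumE tj1 mul1r /slack addrC subrK.
  have [j Sju sumj] := ws u us; exists j => //; rewrite sumE sumj.
  case: (boolP (S j t)) => [/minj1|_]; rewrite ?mul0r ?addr0 // {2}/slack sumj subrr.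
  move=> sl; rewrite mul1r; apply/eqP; rewrite -subr_eq0 addrC addrA addNr add0r.
  by rewrite eq_le sl slack0.
Qed.

(** Finite Vitali covering: keep an element of least [f], discard all that it meets, repeat. In the
    application [e] is intersection of balls and [f] the dyadic level, so least [f] means largest
    radius. *)
Lemma vitali_selection (I : finType) (e : rel I) (f : I -> nat) :
  reflexive e -> symmetric e ->
  exists D : {set I}, {in D &, forall i j, i != j -> ~~ e i j} /\
    forall i, exists2 j, j \in D & e j i && (f j <= f i)%N.
Proof.
move=> erefl esym.
suff /(_ #|I| [set: I]%SET) [|D [_ Dind Dcov]] : forall k (U : {set I}),
    (#|U| <= k)%N -> exists D : {set I}, [/\ D \subset U,
      {in D &, forall i j, i != j -> ~~ e i j} &
      forall i, i \in U -> exists2 j, j \in D & e j i && (f j <= f i)%N].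
- by rewrite cardsT.
- by exists D; split=> // i; apply: Dcov; rewrite finset.in_setT.
elim=> [|k IHk] U Uk.
  have U0 : U = finset.set0 by apply/eqP; rewrite -cards_eq0 -leqn0.
  exists finset.set0; split; rewrite ?finset.sub0set // => i; first by rewrite finset.inE.
  by rewrite U0 finset.inE.
have [U0|[i0 Ui0]] := finset.set_0Vmem U.
  exists finset.set0; split; rewrite ?finset.sub0set // => i; first by rewrite finset.inE.
  by rewrite U0 finset.inE.
have [i1 Ui1 mini1] := @arg_minnP _ i0 (fun i => i \in U) f Ui0.
pose U' : {set I} := [set i in U | ~~ e i1 i]%SET.
have [|D [DU' Dind Dcov]] := IHk U'.
  rewrite -ltnS; apply: leq_trans Uk; apply: proper_card; apply/properP; split.
    by apply/fintype.subsetP => i; rewrite finset.inE => /andP[].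
  by exists i1 => //; rewrite finset.inE erefl andbF.
have DU'P i : i \in D -> (i \in U) && ~~ e i1 i.
  by move=> /(fintype.subsetP DU'); rewrite finset.inE.
exists (i1 |: D)%SET; split.
- apply/fintype.subsetP => i; rewrite finset.in_setU1 => /orP[/eqP->//|/DU'P/andP[]//].
- move=> i j; rewrite !finset.in_setU1 => /orP[/eqP->|iD] /orP[/eqP->|jD].
  + by rewrite eqxx.
  + by case/andP: (DU'P _ jD).
  + by rewrite esym; case/andP: (DU'P _ iD).
  + exact: Dind.
- move=> i Ui; case: (boolP (e i1 i)) => ei.
    by exists i1; rewrite ?finset.setU11 // ei mini1.
  have [|j jD ej] := Dcov i; first by rewrite finset.inE Ui.
  by exists j => //; rewrite finset.in_setU1 jD orbT.
Qed.

Lemma sum_disjoint_le (R : realFieldType) (T I : finType) (S : I -> pred T)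
    (D : {set I}) (w : T -> R) :
  (forall t, 0 <= w t) ->
  {in D &, forall i j, i != j -> ~~ [exists t, S i t && S j t]} ->
  \sum_(i in D) \sum_(t | S i t) w t <= \sum_t w t.
Proof.
move=> w0 disj; rewrite (exchange_big_dep predT) //=; apply: ler_sum => t _.
rewrite sumr_const; suff c1 : (#|[pred i in D | S i t]| <= 1)%N.
  rewrite -mulr_natl -[leRHS]mul1r ler_wpM2r // lern1.
  by move: c1; congr (_ <= _)%N.
apply/card_le1P => i; rewrite !inE => /andP[iD Sit] j; rewrite !inE.
apply/idP/idP => [/andP[jD Sjt]|/eqP->]; last by rewrite iD Sit.
rewrite eq_sym; apply: contraT => /(disj _ _ iD jD) /existsP[]; by exists t; rewrite Sit.
Qed.

(** Cauchy-Schwarz, by expanding the nonnegative double sum of the squares of [v z - v y]. *)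
Lemma sqr_sum_le (R : realFieldType) (Z : finType) (v : Z -> R) :
  (\sum_z v z) ^+ 2 <= #|Z|%:R * \sum_z v z ^+ 2.
Proof.
have : 0 <= \sum_z \sum_y (v z - v y) ^+ 2.
  by apply: sumr_ge0 => z _; apply: sumr_ge0 => y _; exact: sqr_ge0.
rewrite (eq_bigr (fun z => #|Z|%:R * v z ^+ 2 + \sum_y v y ^+ 2
    - 2 * (v z * \sum_y v y))); last first.
  move=> z _; rewrite mulr_sumr mulr_sumr -sumrN mulr_natl -sumr_const -!big_split /=.
  by apply: eq_bigr => y _; ring.
rewrite !big_split /= sumrN -!mulr_sumr -mulr_suml sumr_const -mulr_natl -expr2.
by lra.
Qed.

(** Cauchy-Schwarz over the fibres of [kappa]; in each fibre one of the two factors is then enlarged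
    from [G] to the whole fibre. *)
Lemma sqr_sum_le_fibers (R : realFieldType) (T Z : finType) (w : T -> R)
    (kappa : T -> Z) (G : pred T) :
  (forall t, 0 <= w t) ->
  (\sum_(t | G t) w t) ^+ 2 <=
    #|Z|%:R * \sum_(t | G t) w t * \sum_(u | kappa u == kappa t) w u.
Proof.
move=> w0; rewrite (partition_big kappa predT) //=.
apply: le_trans (sqr_sum_le _) _; rewrite ler_wpM2l //.
rewrite [leRHS](partition_big kappa predT) //=; apply: ler_sum => z _.
rewrite expr2 mulr_suml; apply: ler_sum => t /andP[_ /eqP <-].
rewrite ler_wpM2l // [leRHS](bigID G) /= -[leLHS]addr0.
apply: lerD; last exact: sumr_ge0.
by rewrite (eq_bigl (fun u => (kappa u == kappa t) && G u)) // => u; rewrite andbC.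
Qed.

(** * Counting grid matrices, and summing the resulting kernel *)

Lemma card_spread (R : realType) (K : nat) (P : pred 'I_K) (L : R) :
  0 <= L -> (forall s t, P s -> P t -> `|s%:R - t%:R| <= L) ->
  #|P|%:R <= L + 1.
Proof.
move=> L0 PL; have [t0 Pt0|P0] := pickP P; last by rewrite (eq_card0 P0) addr_ge0.
have [t1 Pt1 mint1] := @arg_minnP _ t0 P (@nat_of_ord K) Pt0.
pose k := Num.truncn L.
pose h (t : 'I_K) : 'I_k.+1 := inord (t - t1).
have hP t : P t -> (t - t1 <= k)%N.
  move=> Pt; rewrite truncn_ge_nat // natrB; last exact: mint1.
  exact: le_trans (ler_norm _) (PL _ _ Pt Pt1).
have hinj : {in P &, injective h}.
  move=> s t Ps Pt /(congr1 val); rewrite /= !inordK ?ltnS ?hP // => st.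
  by apply/val_inj; rewrite /= -(subnKC (mint1 _ Ps)) st subnKC // mint1.
have : (#|P| <= k.+1)%N.
  by rewrite -(card_in_imset hinj) -[leqRHS]card_ord max_card.
rewrite -(ler_nat R) => /le_trans; apply.
by rewrite -natr1 lerD2r truncn_le.
Qed.

Definition ffun_upd (I V : finType) (f : {ffun I -> V}) (l : I) (t : V) :=
  [ffun i => if i == l then t else f i].

(** Fubini for counting: exchanging [f l] with [t] is an involution of the pairs [(f, t)], so the
    pairs with [P f] can be counted slice by slice. *)
Lemma card_slices (R : realFieldType) (I V : finType) (l : I)
    (P : pred {ffun I -> V}) (B : R) :
  (forall f, #|[pred t | P (ffun_upd f l t)]|%:R <= B) ->
  #|P|%:R * #|V|%:R <= #|V|%:R ^+ #|I| * B.
Proof.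
move=> PB.
pose h (p : {ffun I -> V} * V) := (ffun_upd p.1 l p.2, p.1 l).
have hK : cancel h h.
  move=> [f t]; rewrite /h /= ffunE eqxx; congr (_, _).
  by apply/ffunP => i; rewrite !ffunE; case: eqP => // ->.
have -> : #|P|%:R * #|V|%:R = \sum_f #|[pred t | P (ffun_upd f l t)]|%:R :> R.
  rewrite -natrM -natr_sum; congr (_%:R).
  rewrite -sum1_card big_distrl /= big_mkcond /=.
  transitivity (\sum_(p : {ffun I -> V} * V) (P p.1 : nat))%N.
    rewrite -(pair_bigA _ (fun f (t : V) => (P f : nat))) /=; apply: eq_bigr => f _.
    by rewrite sum_nat_const mul1n unfold_in; case: (P f); rewrite ?muln1 ?muln0.
  rewrite (reindex_inj (can_inj hK)) /=.
  rewrite -(pair_bigA _ (fun f (t : V) => (P (ffun_upd f l t) : nat))) /=.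
  apply: eq_bigr => f _; rewrite -sum1_card [RHS]big_mkcond /=.
  by apply: eq_bigr => t _; rewrite inE /=; case: (P _).
apply: le_trans (ler_sum _ (fun f _ => PB f)) _.
by rewrite sumr_const card_ffun -[leLHS]mulr_natl natrX.
Qed.

(** With the other entries fixed, [h l] varies by at most [2 * delta * K / |a l|]. The grid is fine
    enough for [K * delta / |a l|] to absorb the extra 1 of [card_spread], whence the factor 3. *)
Lemma card_row (R : realType) (m K : nat) (a : 'I_m -> R) (c delta : R)
    (l : 'I_m) :
  (0 < K)%N -> 0 < delta -> 0 < `|a l| -> `|a l| <= K%:R * delta ->
  #|[pred h : {ffun 'I_m -> 'I_K} |
     `|c - \sum_i (h i)%:R / K%:R * a i| <= delta]|%:R
    <= 3 * delta / `|a l| * K%:R ^+ m.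
Proof.
move=> K0 d0 al0 alK; set P := [pred h : {ffun _ -> _} | _].
have K0' : 0 < K%:R :> R by rewrite ltr0n.
pose B := 2 * delta * K%:R / `|a l| + 1.
have slice (f : {ffun 'I_m -> 'I_K}) :
    #|[pred t | P (ffun_upd f l t)]|%:R <= B.
  apply: card_spread => [|s t /= Ps Pt].
    by rewrite divr_ge0 ?mulr_ge0 ?ltW.
  rewrite ler_pdivlMr //.
  have E u : \sum_i (ffun_upd f l u i)%:R / K%:R * a i =
      u%:R / K%:R * a l + \sum_(i | i != l) (f i)%:R / K%:R * a i.
    rewrite (bigD1 l) //= ffunE eqxx; congr (_ + _); apply: eq_bigr => i il.
    by rewrite ffunE (negbTE il).
  move: Ps Pt; rewrite !E; set rest := \sum_(_ | _) _ => Ps Pt.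
  have : `|(s%:R - t%:R) * a l / K%:R| <= 2 * delta.
    have -> : (s%:R - t%:R) * a l / K%:R =
      (c - (t%:R / K%:R * a l + rest)) - (c - (s%:R / K%:R * a l + rest)) by ring.
    apply: le_trans (ler_normB _ _) _; lra.
  by rewrite normrM normfV (gtr0_norm K0') ler_pdivrMr // normrM.
have := card_slices slice; rewrite !card_ord => cP.
rewrite -(ler_pM2r K0'); apply: le_trans cP _.
rewrite [leRHS]mulrAC [leRHS]mulrC ler_wpM2l ?exprn_ge0 // /B.
have : 1 <= K%:R * delta / `|a l| by rewrite ler_pdivlMr // mul1r.
move=> h; rewrite -subr_ge0.
have -> : 3 * delta / `|a l| * K%:R - (2 * delta * K%:R / `|a l| + 1) =
  K%:R * delta / `|a l| - 1 by ring.
by rewrite subr_ge0.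
Qed.

Notation grid m K := {ffun 'I_m -> {ffun 'I_m -> 'I_K}}.

(** The vector [b - g a], zero exactly on V_g. The integer array [g] stands for the matrix with
    entries [g i l / K]. *)
Definition slope (R : realType) (m K : nat) (g : grid m K) (a b : 'I_m -> R)
    (i : 'I_m) : R :=
  b i - \sum_l (g i l)%:R / K%:R * a l.

Lemma grid_entry_bounds (R : realType) (m K : nat) (g : grid m K) i l :
  0 <= ((g i l)%:R / K%:R : R) <= 1.
Proof.
have K0 : (0 < K)%N by apply: leq_trans (ltn_ord (g i l)).
rewrite divr_ge0 //= ler_pdivrMr ?ltr0n // mul1r ler_nat.
exact/ltnW/ltn_ord.
Qed.

Lemma slope_sum_le (R : realType) (m K : nat) (g : grid m K) (a : 'I_m -> R)
    (D : R) i :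
  (forall l, `|a l| <= D) ->
  `|\sum_l (g i l)%:R / K%:R * a l| <= m%:R * D.
Proof.
move=> aD; apply: le_trans (ler_norm_sum _ _ _) _.
rewrite mulr_natl -[m in leRHS]card_ord -sumr_const; apply: ler_sum => l _.
have /andP[g0 g1] := grid_entry_bounds R g i l.
by rewrite normrM (ger0_norm g0); apply: le_trans (aD l); rewrite ler_piMl.
Qed.

(** If some [|a l|] is at least [rho / 2m], [card_row] applies to each of the m rows independently.
    Otherwise [g a] has entries at most [rho / 2] while some [|b i|] is at least [rho], so no [g]
    qualifies if [delta < rho / 2]; for larger [delta] the bound exceeds the number of all
    matrices. *)
Lemma card_grid_slope (R : realType) (m K : nat) (a b : 'I_m -> R)
    (delta rho : R) :
  (0 < K)%N -> 0 < delta -> 0 < rho -> (forall l, `|a l| <= K%:R * delta) ->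
  (exists i, rho <= `|a i| \/ rho <= `|b i|) ->
  #|[pred g : grid m K | [forall i, `|slope g a b i| <= delta]]|%:R
    <= (6 * m%:R * delta / rho) ^+ m * #|{: grid m K}|%:R.
Proof.
move=> K0 d0 r0 aK [i0 i0P].
have m0 : (0 < m)%N by apply: leq_trans (ltn_ord i0).
have m0' : 1 <= m%:R :> R by rewrite ler1n.
set c := 6 * m%:R * delta / rho.
have c0 : 0 <= c by rewrite divr_ge0 ?mulr_ge0 ?ltW //; lra.
have cardG : #|{: grid m K}|%:R = (K%:R ^+ m) ^+ m :> R.
  by rewrite card_ffun card_ffun !card_ord !natrX.
case: (boolP [exists l, rho / (2 * m%:R) <= `|a l|]) => [/existsP[l al]|/existsPn al].
  have al0 : 0 < `|a l|.
    by apply: lt_le_trans al; rewrite divr_gt0 // mulr_gt0 //; lra.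
  pose F i : pred {ffun 'I_m -> 'I_K} :=
    [pred h : {ffun 'I_m -> 'I_K} | `|b i - \sum_l (h l)%:R / K%:R * a l| <= delta].
  have -> : #|[pred g : grid m K | [forall i, `|slope g a b i| <= delta]]| =
      #|family F| by apply: eq_card => g; rewrite !inE.
  rewrite card_family foldrE big_map big_enum /= natr_prod cardG -exprMn.
  rewrite -[m in leRHS]card_ord -prodr_const; apply: ler_prod => i _.
  rewrite ler0n /=; apply: le_trans (card_row _ K0 d0 al0 (aK l)) _.
  rewrite card_ord ler_wpM2r ?exprn_ge0 // /c ler_pdivrMr // mulrAC ler_pdivlMr //.
  have : rho <= `|a l| * (2 * m%:R) by rewrite -ler_pdivrMr // mulr_gt0 //; lra.
  by move=> h; nra.
have {}al l : `|a l| <= rho / (2 * m%:R) by apply/ltW; rewrite ltNge al.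
have [dr|rd] := ltP delta (rho / 2); last first.
  apply: le_trans (_ : 1 * #|{: grid m K}|%:R <= _).
    by rewrite mul1r ler_nat max_card.
  rewrite ler_wpM2r // exprn_ege1 // /c ler_pdivlMr //; nra.
rewrite eq_card0 ?mulr_ge0 ?exprn_ge0 // => g; rewrite !inE.
apply/negbTE/forallPn; exists i0; rewrite -ltNge.
have bi : rho <= `|b i0|.
  case: i0P => // rai; apply: contraT => _; move: (al i0).
  rewrite leNgt => /negP[]; apply: lt_le_trans rai.
  by rewrite ltr_pdivrMr ?mulr_gt0 //; nra.
have := slope_sum_le g i0 al; rewrite invfM mulrCA [m%:R * _]mulrCA.
rewrite divff ?pnatr_eq0 -?lt0n // mulr1.
rewrite /slope; set S := \sum_l _ => hS.
have := lerB_normD (b i0) (- S); rewrite normrN; lra.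
Qed.

Definition grid_tr (m K : nat) (g : grid m K) : grid m K :=
  [ffun l => [ffun i => g i l]].

Lemma grid_trK (m K : nat) : involutive (@grid_tr m K).
Proof. by move=> g; apply/ffunP => i; apply/ffunP => l; rewrite !ffunE. Qed.

Lemma card_grid_tr (m K : nat) (P : pred (grid m K)) :
  #|[pred g | P (grid_tr g)]| = #|P|.
Proof. by rewrite -!sum1_card [RHS](reindex_inj (inv_inj (@grid_trK m K))). Qed.

(* Peeling off dyadic annuli: at distance about [2^-j] the kernel [p] is at most
   [(2 C 2^-(N-j))^m] while the mass is at most [q^j], so the geometric series of
   ratio [2^m q] bounds the total. *)
Lemma kernel_sum_le (R : realType) (T : finType) (w p d : T -> R) (m N k : nat)
    (q C : R) :
  (forall u, 0 <= w u) -> (forall u, 0 <= p u <= 1) ->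
  0 <= q -> 2 ^+ m * q < 1 -> 1 <= C -> (k <= N)%N ->
  (forall j, (k <= j <= N)%N -> \sum_(u | d u <= 2^-1 ^+ j) w u <= q ^+ j) ->
  (forall u rho, 0 < rho -> rho <= d u -> p u <= (C * 2^-1 ^+ N / rho) ^+ m) ->
  \sum_(u | d u <= 2^-1 ^+ k) w u * p u <=
    (2^-1 ^+ N) ^+ m * (2 * C) ^+ m * (2 ^+ m * q) ^+ k / (1 - 2 ^+ m * q).
Proof.
move=> w0 p01 q0 Q1 C1 kN; set Q := 2 ^+ m * q.
have Q0 : 0 <= Q by rewrite mulr_ge0 // exprn_ge0.
have Q1' : 0 < 1 - Q by rewrite subr_gt0.
have h0 j : 0 < 2^-1 ^+ j :> R by rewrite exprn_gt0.
move=> wq pC.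
have C2 : 1 <= (2 * C) ^+ m by rewrite exprn_ege1 //; lra.
(* Induction on [N - k]. For [k = N] the bound [p u <= 1] suffices, as [q ^ N] equals 2^-Nm times
   [(2 ^ m * q) ^ N]. *)
have [i ik] : exists i, (k + i)%N = N by exists (N - k)%N; rewrite subnKC.
elim: i k kN ik wq => [|i IHi] k kN ik wq.
  have -> : k = N by rewrite -ik addn0.
  apply: le_trans (_ : \sum_(u | d u <= 2^-1 ^+ N) w u <= _).
    by apply: ler_sum => u _; have /andP[_ p1] := p01 u; rewrite ler_piMr.
  apply: le_trans (wq N _) _; first by rewrite kN leqnn.
  have -> : q ^+ N = (2^-1 ^+ N) ^+ m * Q ^+ N.
    rewrite /Q exprMn mulrA -!exprM [(m * N)%N]mulnC -exprMn.
    by rewrite mulVf // expr1n mul1r.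
  rewrite ler_pdivlMr //; apply: le_trans (_ : (2^-1 ^+ N) ^+ m * Q ^+ N <= _).
    by rewrite ler_piMr ?mulr_ge0 ?exprn_ge0 //; lra.
  by rewrite ler_wpM2r ?exprn_ge0 // ler_peMr // exprn_ge0 // ltW.
have kN' : (k.+1 <= N)%N by rewrite -ik -addSnnS leq_addr.
have {}IHi : \sum_(u | d u <= 2^-1 ^+ k.+1) w u * p u <=
    (2^-1 ^+ N) ^+ m * (2 * C) ^+ m * Q ^+ k.+1 / (1 - Q).
  apply: IHi => // [|j /andP[kj jN]]; first by rewrite addSnnS.
  by apply: wq; rewrite (ltnW kj).
rewrite (bigID (fun u => d u <= 2^-1 ^+ k.+1)) /=.
rewrite (eq_bigl (fun u => d u <= 2^-1 ^+ k.+1)); last first.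
  move=> u; apply/andP/idP => [[]//|du]; split=> //; apply: le_trans du _.
  by rewrite exprS ler_piMl ?ltW //; lra.
set X := (2^-1 ^+ N) ^+ m * (2 * C) ^+ m in IHi *.
have annulus : \sum_(u | (d u <= 2^-1 ^+ k) && ~~ (d u <= 2^-1 ^+ k.+1)) w u * p u
    <= X * Q ^+ k.
  have -> : X * Q ^+ k = q ^+ k * (C * 2^-1 ^+ N / 2^-1 ^+ k.+1) ^+ m.
    have -> : C * 2^-1 ^+ N / 2^-1 ^+ k.+1 = 2^-1 ^+ N * (2 * C) * 2 ^+ k.
      by rewrite [X in _ / X]exprVn invrK exprS; ring.
    rewrite /X /Q !exprMn -!exprM [(m * k)%N]mulnC; ring.
  apply: le_trans (_ : \sum_(u | d u <= 2^-1 ^+ k) w u *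
      (C * 2^-1 ^+ N / 2^-1 ^+ k.+1) ^+ m <= _); last first.
    rewrite -mulr_suml ler_wpM2r ?wq ?kN ?leqnn // exprn_ge0 // divr_ge0 ?ltW //.
    by rewrite mulr_gt0 //; lra.
  rewrite [leRHS](bigID (fun u => d u <= 2^-1 ^+ k.+1)) /= -[leLHS]add0r.
  apply: lerD.
    apply: sumr_ge0 => u _; rewrite mulr_ge0 // exprn_ge0 // divr_ge0 ?ltW //.
    by rewrite mulr_gt0 //; lra.
  apply: ler_sum => u /andP[_]; rewrite -ltNge => du.
  by rewrite ler_wpM2l // pC // ltW.
apply: le_trans (lerD IHi annulus) _.
rewrite le_eqVlt; apply/orP; left; apply/eqP; rewrite exprS; field.
by rewrite subr_eq0 gt_eqF.
Qed.

(** * Tubes, and orthogonal slabs in R^m x R^m *)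

(** Cut the cube [-B, B]^m into cells of side [delta]: since [delta <= B], there are at most
    [(2B/delta + 1)^m <= (3B/delta)^m] of them, and points projecting to one cell lie in each
    other's tubes. *)
Lemma sqr_mass_le_tubes (R : realType) (T : finType) (m : nat) (w : T -> R)
    (pr : T -> 'I_m -> R) (B delta : R) (G : pred T) :
  (forall t, 0 <= w t) -> (forall t i, `|pr t i| <= B) ->
  0 < delta -> delta <= B ->
  (\sum_(t | G t) w t) ^+ 2 <= (3 * B / delta) ^+ m *
    \sum_(t | G t) w t * \sum_(u | [forall i, `|pr u i - pr t i| <= delta]) w u.
Proof.
move=> w0 prB d0 dB; pose L := Num.truncn (2 * B / delta).
pose x t i := (pr t i + B) / delta.
have x0 t i : 0 <= x t i.
  by rewrite divr_ge0 ?(ltW d0) //; move: (prB t i); rewrite ler_norml; lra.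
have xL t i : (Num.truncn (x t i) < L.+1)%N.
  rewrite ltnS; apply: le_truncn; rewrite ler_pM2r ?invr_gt0 //.
  by move: (prB t i); rewrite ler_norml; lra.
pose kappa t : {ffun 'I_m -> 'I_L.+1} := [ffun i => inord (Num.truncn (x t i))].
have kappaP t u i : kappa u = kappa t -> `|pr u i - pr t i| <= delta.
  move=> /ffunP/(_ i); rewrite !ffunE => /(congr1 val); rewrite /= !inordK ?xL // => xx.
  have /andP[t1 t2] := truncn_itv (x0 t i); have /andP[u1 u2] := truncn_itv (x0 u i).
  rewrite xx -natr1 in u1 u2; rewrite -natr1 in t2.
  have -> : pr u i - pr t i = (x u i - x t i) * delta.
    by rewrite /x -mulrBl opprD addrACA subrr addr0 divfK ?gt_eqF.
  by rewrite normrM (gtr0_norm d0) ler_piMl ?(ltW d0) // ler_norml; lra.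
apply: le_trans (sqr_sum_le_fibers kappa G w0) _.
apply: ler_pM => //.
- by apply: sumr_ge0 => t _; rewrite mulr_ge0 // sumr_ge0.
- rewrite card_ffun !card_ord natrX lerXn2r ?nnegrE //.
    by rewrite divr_ge0 ?(ltW d0) //; lra.
  have B0 : 0 <= 2 * B / delta by rewrite divr_ge0 ?(ltW d0) //; lra.
  have /andP[L1 _] := truncn_itv B0; rewrite -natr1.
  have : 1 <= B / delta by rewrite ler_pdivlMr // mul1r.
  by rewrite -/L in L1; move: L1; rewrite -!mulrA; lra.
- apply: ler_sum => t _; rewrite ler_wpM2l //.
  rewrite [leRHS](bigID (fun u => kappa u == kappa t)) /= -[leLHS]addr0.
  apply: lerD; last exact: sumr_ge0.
  rewrite le_eqVlt; apply/orP; left; apply/eqP; apply: eq_bigl => u.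
  case: eqP => [kk|_]; rewrite ?andbF ?andbT //.
  by apply/esym/forallP => i; exact: kappaP.
Qed.

(** Indexing by [nat] with default 0 embeds R^n into R^m x R^m for any [n <= m + m] without casts;
    [lower] and [upper] are the two halves. *)
Definition padded (R : realType) (n : nat) (x : 'rV[R]_n) (k : nat) : R :=
  if insub k is Some i then x ord0 i else 0.

Definition lower (R : realType) (n m : nat) (x : 'rV[R]_n) (i : 'I_m) : R :=
  padded x i.

Definition upper (R : realType) (n m : nat) (x : 'rV[R]_n) (i : 'I_m) : R :=
  padded x (m + i).

Lemma padded_ord (R : realType) (n : nat) (x : 'rV[R]_n) (i : 'I_n) :
  padded x i = x ord0 i.
Proof. by rewrite /padded valK. Qed.

Lemma paddedB (R : realType) (n : nat) (x y : 'rV[R]_n) k :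
  padded (x - y) k = padded x k - padded y k.
Proof. by rewrite /padded; case: insub => [i|]; rewrite ?mxE ?subr0. Qed.

Lemma coord_le_norm (R : realType) (n : nat) (x : 'rV[R]_n) (i : 'I_n) :
  `|x ord0 i| <= `|x|.
Proof.
rewrite [leRHS]mx_normrE.
exact: (le_bigmax _ (fun ij => `|x ij.1 ij.2|) (ord0, i)).
Qed.

Lemma padded_le_norm (R : realType) (n : nat) (x : 'rV[R]_n) k :
  `|padded x k| <= `|x|.
Proof.
by rewrite /padded; case: insub => [i|]; rewrite ?coord_le_norm ?normr0.
Qed.

Lemma norm_le_halves (R : realType) (n m : nat) (x : 'rV[R]_n) (rho : R) :
  (n <= m + m)%N -> 0 < rho -> rho <= `|x| ->
  exists i : 'I_m, rho <= `|lower x i| \/ rho <= `|upper x i|.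
Proof.
move=> nm r0 rx; have /mx_norm_neq0[[i0 i] xi] : mx_norm x != 0.
  by rewrite gt_eqF // (lt_le_trans r0).
have {}rx : rho <= `|padded x i|.
  by rewrite padded_ord; move: rx; rewrite [`|x|]xi /= ord1.
have [im|mi] := ltnP i m; first by exists (Ordinal im); left.
have im : (i - m < m)%N by rewrite ltn_subLR // (leq_trans (ltn_ord i)).
by exists (Ordinal im); right; rewrite /upper /= subnKC.
Qed.

Lemma dotp_halves (R : realType) (n m : nat) (x y : 'rV[R]_n) :
  (n <= m + m)%N ->
  dotp x y = \sum_(i < m) lower x i * lower y i + \sum_(i < m) upper x i * upper y i.
Proof.
move=> nm; transitivity (\sum_(k < m + m) padded x k * padded y k); last first.
  by rewrite big_split_ord.
transitivity (\sum_(k < n) padded x k * padded y k).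
  by apply: eq_bigr => i _; rewrite !padded_ord.
rewrite (big_ord_widen _ (fun k => padded x k * padded y k) nm) big_mkcond /=.
apply: eq_bigr => k _; case: ifPn => // kn.
by rewrite /padded insubN // mul0r.
Qed.

Lemma slope_sub (R : realType) (m K : nat) (g : grid m K)
    (a a' b b' : 'I_m -> R) i :
  slope g (fun l => a l - a' l) (fun l => b l - b' l) i =
  slope g a b i - slope g a' b' i.
Proof.
rewrite /slope.
under eq_bigr do rewrite mulrBr.
by rewrite sumrB; ring.
Qed.

(** Quantitative orthogonality of the two planes: [a.a' + b.b' = a.(a' + g^T b') + (b - g a).b'],
    since the terms in [g] cancel. *)
Lemma dot_slope_le (R : realType) (m K : nat) (g : grid m K)
    (a b a' b' : 'I_m -> R) (D delta : R) :
  (forall i, `|a i| <= D) -> (forall i, `|b' i| <= D) ->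
  (forall i, `|slope g a b i| <= delta) ->
  (forall i, `|slope (grid_tr g) (fun l => - b' l) a' i| <= delta) ->
  `|\sum_i a i * a' i + \sum_i b i * b' i| <= 2 * (m%:R * (D * delta)).
Proof.
move=> aD bD sd sd'.
have -> : \sum_i a i * a' i + \sum_i b i * b' i =
    \sum_i a i * slope (grid_tr g) (fun l => - b' l) a' i +
    \sum_i slope g a b i * b' i.
  rewrite /slope.
  under [X in _ = X + _]eq_bigr => i _ do rewrite mulrBr mulr_sumr.
  under [X in _ = _ + X]eq_bigr => i _ do rewrite mulrBl mulr_suml.
  rewrite !sumrB addrACA -opprD.
  suff -> : \sum_i \sum_l a i * ((grid_tr g i l)%:R / K%:R * - b' l) +
     \sum_i \sum_l (g i l)%:R / K%:R * a l * b' i = 0 by rewrite subr0.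
  rewrite [X in _ + X]exchange_big /= -big_split /= big1 // => i _.
  rewrite -big_split /= big1 // => l _; rewrite !ffunE; ring.
apply: le_trans (ler_normD _ _) _; rewrite mulr2n mulrDl mul1r.
apply: lerD; apply: le_trans (ler_norm_sum _ _ _) _;
  rewrite mulr_natl -[m in leRHS]card_ord -sumr_const; apply: ler_sum => i _;
  rewrite normrM.
  exact: ler_pM.
by rewrite mulrC; exact: ler_pM.
Qed.

(** * Consequences of compactness *)

(** The triples with both sides at least [r] form a compact set, on which the continuous function
    [|dotp|] attains a minimum, nonzero by hypothesis. *)
Lemma right_angle_gap (R : realType) (n : nat) (A : set 'rV[R]_n) (r : R) :
  compact A -> 0 < r ->
  (forall x y z, A x -> A y -> A z -> y <> x -> z <> x ->
    dotp (y - x) (z - x) <> 0) ->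
  exists2 eta : R, 0 < eta & forall x y z, A x -> A y -> A z ->
    r <= `|y - x| -> r <= `|z - x| -> eta <= `|dotp (y - x) (z - x)|.
Proof.
move=> cA r0 nA.
pose V := 'rV[R]_n.
pose Y (p : V * (V * V)) := p.2.1 - p.1; pose Z (p : V * (V * V)) := p.2.2 - p.1.
have c1 : continuous (fun p : V * (V * V) => p.1) by move=> p; exact: cvg_fst.
have c2 : continuous (fun p : V * (V * V) => p.2) by move=> p; exact: cvg_snd.
have cY : continuous Y.
  move=> p; apply: cvgB; last exact: c1.
  by apply: (@continuous_comp _ _ _ snd fst); [exact: c2|exact: cvg_fst].
have cZ : continuous Z.
  move=> p; apply: cvgB; last exact: c1.
  by apply: (@continuous_comp _ _ _ snd snd); [exact: c2|exact: cvg_snd].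
pose f p : R := `|dotp (Y p) (Z p)|.
have cf : continuous f.
  move=> p; apply: cvg_norm; move: p; apply: continuous_big => [|i _ p].
    exact: add_continuous.
  apply: cvgM.
    by apply: (@continuous_comp _ _ _ Y (fun v : V => v ord0 i));
      [exact: cY|exact: coord_continuous].
  by apply: (@continuous_comp _ _ _ Z (fun v : V => v ord0 i));
      [exact: cZ|exact: coord_continuous].
pose S := (A `*` (A `*` A)) `&`
  ([set p | r <= `|Y p|] `&` [set p | r <= `|Z p|]).
have cS : compact S.
  apply: compact_closedI; first by do 2!apply: compact_setX => //.
  apply: closedI.
    apply: (@preimage_closed _ _ (fun p => `|Y p|) [set t | r <= t]); last exact: closed_ge.
    by move=> p _; apply: cvg_norm; exact: cY.
  apply: (@preimage_closed _ _ (fun p => `|Z p|) [set t | r <= t]); last exact: closed_ge.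
  by move=> p _; apply: cvg_norm; exact: cZ.
have [S0|/set0P/negP/negPn/eqP S0] := pselect (S !=set0); last first.
  exists 1 => // x y z Ax Ay Az ry rz.
  have : S (x, (y, z)) by [].
  by rewrite S0.
have [c cSc cmin] := compact_EVT_min S0 cS (continuous_subspaceT cf).
exists (f c).
  case: c cSc {cmin} => x [y z]; rewrite inE => -[[/= Ax [Ay Az]] [/= ry rz]].
  move: ry rz; rewrite /f /Y /Z /= => ry rz.
  rewrite normr_gt0; apply/eqP; apply: nA => // E.
    by move: ry; rewrite E subrr normr0 leNgt r0.
  by move: rz; rewrite E subrr normr0 leNgt r0.
by move=> x y z Ax Ay Az ry rz; apply: (cmin (x, (y, z))); rewrite inE.
Qed.

Lemma compact_finite_net (R : realType) (n : nat) (A : set 'rV[R]_n) (e : R) :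
  compact A -> 0 < e -> exists (T : finType) (X : T -> 'rV[R]_n),
    (forall t, A (X t)) /\ forall x, A x -> exists t, `|x - X t| <= e.
Proof.
move=> cA e0; pose f (x : 'rV[R]_n) := ball x e.
have openf x : A x -> open (f x) by move=> _; exact: ball_open.
have cf : A `<=` cover A f by move=> x Ax; exists x => //; exact: ballxx.
move: cA; rewrite compact_cover => /(_ _ _ _ openf cf)[D' D'A AD'].
pose s := finmap.enum_fset D'.
exists 'I_(size s), (fun i : 'I_(size s) => nth 0 s i); split=> [i|x /AD'[y /= yD' yx]].
  by apply/set_mem/D'A; exact: mem_nth.
have ys : (index y s < size s)%N by rewrite index_mem.
exists (Ordinal ys); rewrite /= nth_index // distrC; apply: ltW.
by move: yx; rewrite /f -ball_normE.
Qed.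

Lemma compact_norm_bound (R : realType) (n : nat) (A : set 'rV[R]_n) :
  compact A -> exists2 D : R, 1 <= D & forall x, A x -> `|x| <= D.
Proof.
move=> /compact_bounded[M [_ AM]].
exists (Num.max 1 (M + 1)); first by rewrite le_max lexx.
move=> x Ax; rewrite le_max; apply/orP; right.
by apply: (AM (M + 1)) => //; rewrite ltrDl.
Qed.

(** * Hausdorff measure and the discrete Frostman lemma *)

Lemma enorm_le (R : realType) (n : nat) (u : 'rV[R]_n) (B : R) :
  0 <= B -> `|u| <= B -> enorm u <= n%:R * B.
Proof.
move=> B0 uB; rewrite /enorm -(ger0_norm (_ : 0 <= n%:R * B)) ?mulr_ge0 //.
rewrite -sqrtr_sqr ler_wsqrtr // exprMn; apply: le_trans (_ : n%:R * B ^+ 2 <= _).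
  rewrite mulr_natl -[n in leRHS]card_ord -sumr_const; apply: ler_sum => i _.
  rewrite -expr2 -real_normK ?num_real // lerXn2r ?nnegrE //.
  exact: le_trans (coord_le_norm _ _) uB.
rewrite ler_wpM2r ?sqr_ge0 // -natrX ler_nat.
by case: n {u uB} => // n; rewrite leq_pmulr.
Qed.

Lemma ediam_ge0 (R : realType) (n : nat) (U : set 'rV[R]_n) :
  U !=set0 -> (0 <= ediam U)%E.
Proof.
move=> [x Ux]; apply: ereal_sup_ubound; exists x, x; split=> //.
by rewrite subrr /enorm /dotp big1 ?sqrtr0 // => i _; rewrite mxE mul0r.
Qed.

Lemma hausdorff_premeasure_ge0 (R : realType) (n : nat) (s delta : R)
    (A : set 'rV[R]_n) : (0 <= hausdorff_premeasure s delta A)%E.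
Proof.
apply: le_ereal_inf_tmp => _ [U [_ _ ->]].
by apply: nneseries_ge0 => i _ _; exact: poweR_ge0.
Qed.

Lemma hausdorff_premeasure_le_finite (R : realType) (n N : nat) (s delta : R)
    (A : set 'rV[R]_n) (V : 'I_N -> set 'rV[R]_n) (d : 'I_N -> R) :
  0 <= s -> A `<=` \bigcup_i V i -> (forall i, 0 <= d i <= delta) ->
  (forall i, (ediam (V i) <= (d i)%:E)%E) ->
  (hausdorff_premeasure s delta A <= (\sum_i d i `^ s)%:E)%E.
Proof.
move=> s0 AV d0 Vd.
pose U (i : nat) := if insub i is Some k then V k else set0.
have UV (i : 'I_N) : U i = V i by rewrite /U valK.
have U0 i : (N <= i)%N -> U i = set0 by move=> Ni; rewrite /U insubN // -leqNgt.
have ediam0 : ediam (set0 : set 'rV[R]_n) = -oo%E.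
  rewrite /ediam [X in ereal_sup X](_ : _ = set0) ?ereal_sup0 //.
  by apply/seteqP; split=> // y [? [? []]].
apply: le_trans (ereal_inf_lbound _) _.
  exists U; split; last reflexivity.
    by move=> x /AV[i _ Vx]; exists (val i) => //; rewrite UV.
  move=> i; have [iN|Ni] := ltnP i N; last by rewrite U0 // ediam0 leNye.
  rewrite (UV (Ordinal iN)); apply: le_trans (Vd _) _.
  by rewrite lee_fin; case/andP: (d0 (Ordinal iN)).
rewrite (nneseries_split_cond 0 N); last by move=> k _; exact: poweR_ge0.
rewrite add0n [X in (_ + X)%E]eseries0; last first.
  by move=> i Ni; rewrite (U0 i Ni) => /asboolP[].
rewrite adde0 big_mkcond big_mkord -sumEFin; apply: lee_sum => i _.
rewrite UV; case: asboolP => [V0|_]; last by rewrite lee_fin powR_ge0.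
rewrite -poweR_EFin; apply: gt0_ler_poweR => //.
  by rewrite in_itv /= ediam_ge0 //= leey.
by rewrite in_itv /= leey andbT lee_fin; case/andP: (d0 i).
Qed.

(** Nonzero measure gives a positive premeasure at some scale [delta], and [J] makes all the balls
    admissible at that scale. The radius factor 4 is the Vitali enlargement of
    [discrete_frostman]. *)
Lemma ball_cover_lower_bound (R : realType) (n : nat) (s : R)
    (A : set 'rV[R]_n) :
  0 <= s -> hausdorff_measure s A <> 0%E ->
  exists (J : nat) (c : R), 0 < c /\
    forall (T : finType) (D : {set T}) (X : T -> 'rV[R]_n) (j : T -> nat),
    {in D, forall t, (J <= j t)%N} ->
    (forall x, A x -> exists2 t, t \in D & `|x - X t| <= 4 * 2^-1 ^+ j t) ->
    c <= \sum_(t in D) (2^-1 `^ s) ^+ j t.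
Proof.
move=> s0 HA.
have [delta d0 Hd] : exists2 delta : R, 0 < delta & (0 < hausdorff_premeasure s delta A)%E.
  apply: contrapT => nd; apply: HA; apply/eqP; rewrite eq_le; apply/andP; split.
    apply: ge_ereal_sup => _ [delta d0 ->]; rewrite leNgt; apply/negP => H.
    by apply: nd; exists delta.
  apply: le_trans (hausdorff_premeasure_ge0 s 1 A) _.
  by apply: ereal_sup_ubound; exists 1.
have [c c0 cH] : exists2 c : R, 0 < c & (c%:E <= hausdorff_premeasure s delta A)%E.
  case: (hausdorff_premeasure s delta A) Hd => [c||] //; last by exists 1; rewrite ?leey.
  by rewrite lte_fin => c0; exists c.
(* A sup-norm ball of radius 4h has Euclidean diameter at most [n * 8h]; the successor keeps [M]
   positive for [n = 0]. *)
pose M : R := n.+1%:R * 8.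
have M0 : 0 < M by rewrite mulr_gt0.
have [J _ hJ] : \forall k \near \oo, M * 2^-1 ^+ k < delta.
  have : (geometric M 2^-1 k @[k --> \oo] --> (0 : R)).
    by apply: cvg_geometric; rewrite gtr0_norm //; lra.
  by move=> /cvgr_lt; apply.
exists J, (c / M `^ s); split; first by rewrite divr_gt0 // powR_gt0.
move=> T D X j Dj cov; rewrite ler_pdivrMr ?powR_gt0 //.
rewrite mulr_suml big_enum_val.
have -> : \sum_(i < #|D|) (2^-1 `^ s) ^+ j (enum_val i) * M `^ s =
    \sum_(i < #|D|) (M * 2^-1 ^+ j (enum_val i)) `^ s.
  apply: eq_bigr => i _; rewrite powRM ?(ltW M0) ?exprn_ge0 // mulrC; congr (_ * _).
  elim: (j _) => [|k IHk]; first by rewrite !expr0 powR1.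
  by rewrite !exprS IHk powRM // exprn_ge0.
rewrite -lee_fin; apply: le_trans cH _.
pose V (i : 'I_#|D|) : set 'rV[R]_n :=
  [set x | `|x - X (enum_val i)| <= 4 * 2^-1 ^+ j (enum_val i)].
apply: (@hausdorff_premeasure_le_finite _ _ _ _ _ _ V) => //.
- move=> x /cov[t tD xt]; exists (enum_rank_in tD t) => //.
  by rewrite /V /= enum_rankK_in.
- move=> i; rewrite mulr_ge0 ?(ltW M0) ?exprn_ge0 //=; apply/ltW/hJ.
  exact/Dj/enum_valP.
- move=> i; apply: ge_ereal_sup => _ [x [y [/= xi yi ->]]].
  rewrite lee_fin.
  have h0 : 0 <= 2^-1 ^+ j (enum_val i) :> R by rewrite exprn_ge0.
  set h := 2^-1 ^+ _ in xi yi h0 *.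
  apply: le_trans (enorm_le (_ : 0 <= 8 * h) _) _; rewrite ?mulr_ge0 //.
    have -> : x - y = (x - X (enum_val i)) - (y - X (enum_val i)).
      by rewrite opprB addrA subrK.
    apply: le_trans (ler_normB _ _) _; move: xi yi; rewrite /V /= -/h; lra.
  by rewrite /M -mulrA ler_wpM2r ?mulr_ge0 // ler_nat.
Qed.

(** Saturate weights on a 2^-N-net under the ball constraints of levels J to N. Disjoint saturated
    balls chosen by Vitali have enlargements covering [A], so their total mass is at least the [c]
    of the covering bound. *)
Lemma discrete_frostman (R : realType) (n : nat) (s : R) (A : set 'rV[R]_n) :
  compact A -> 0 <= s -> hausdorff_measure s A <> 0%E ->
  exists (J : nat) (c : R), 0 < c /\ forall N, (J <= N)%N ->
    exists (T : finType) (X : T -> 'rV[R]_n) (w : T -> R),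
    [/\ forall t, A (X t), forall t, 0 <= w t,
        forall t j, (J <= j <= N)%N ->
          \sum_(u | `|X u - X t| <= 2^-1 ^+ j) w u <= (2^-1 `^ s) ^+ j &
        c <= \sum_t w t].
Proof.
move=> cA s0 /(ball_cover_lower_bound s0)[J [c [c0 cov]]].
exists J, c; split=> // N JN.
have h0 j : 0 < 2^-1 ^+ j :> R by rewrite exprn_gt0.
have [T [X [AX net]]] := compact_finite_net cA (h0 N).
pose lev (p : T * 'I_(N - J).+1) := (J + p.2)%N.
pose S p u := `|X u - X p.1| <= 2^-1 ^+ lev p.
have [||w [w0 wb wsat]] :=
  @saturated_weights R T _ S (fun p => (2^-1 `^ s) ^+ lev p).
- by move=> p; rewrite exprn_ge0 // powR_ge0.
- by move=> t; exists (t, ord0); rewrite /S /= subrr normr0 ltW.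
exists T, X, w; split=> // [t j /andP[Jj jN]|].
  have jk : (j - J < (N - J).+1)%N by rewrite ltnS leq_sub2r.
  by have := wb (t, Ordinal jk); rewrite /S /lev /= subnKC.
have [p pS psat] := fin_all_exists2 wsat.
have levN q : (lev q <= N)%N by rewrite /lev -leq_subRL // -ltnS.
have [||D [Dind Dcov]] := @vitali_selection T
    (fun t t' => [exists u, S (p t) u && S (p t') u]) (fun t => lev (p t)).
- by move=> t; apply/existsP; exists t; rewrite pS.
- by move=> t t'; apply: eq_existsb => u; rewrite andbC.
apply: le_trans (sum_disjoint_le w0 Dind).
under eq_bigr do rewrite psat.
apply: (cov T D (fun t => X (p t).1) (fun t => lev (p t))) => [t _|x Ax].
  exact: leq_addr.
have [t xt] := net _ Ax.
have [t' t'D /andP[/existsP[u /andP[ut' ut]] tt']] := Dcov t.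
exists t' => //.
have hle i j : (i <= j)%N -> 2^-1 ^+ j <= 2^-1 ^+ i :> R.
  by move=> ij; rewrite ler_wiXn2l //; lra.
have h1 := hle _ _ tt'; have h2 := hle _ _ (levN (p t')).
(* Path from [x] through the net point, the centre of its ball and a common point to the selected
   centre: four steps, each at most the selected radius. *)
have -> : x - X (p t').1 = (x - X t) + (X t - X (p t).1) - (X u - X (p t).1)
    + (X u - X (p t').1) by rewrite subrKA opprB !subrKA.
have := pS t; rewrite /S in ut ut' * => tt.
apply: le_trans (ler_normD _ _) _.
have := ler_normB (x - X t + (X t - X (p t).1)) (X u - X (p t).1).
have := ler_normD (x - X t) (X t - X (p t).1).
by lra.
Qed.

(** * The mass bound from averaging over the grid *)

(** For the points [t] summed on the left the whole tube is close to [t], so the inner sum of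
    [sqr_mass_le_tubes] only sees close pairs. *)
Lemma sqr_narrow_mass_le (R : realType) (T : finType) (m : nat) (w : T -> R)
    (pr : T -> 'I_m -> R) (B delta : R) (close : rel T) :
  (forall t, 0 <= w t) -> (forall t i, `|pr t i| <= B) ->
  0 < delta -> delta <= B ->
  (\sum_(t | [forall u, [forall i, `|pr u i - pr t i| <= delta] ==> close t u]) w t) ^+ 2
  <= (3 * B / delta) ^+ m * \sum_t w t *
    \sum_(u | close t u) w u * [forall i, `|pr u i - pr t i| <= delta]%:R.
Proof.
move=> w0 prB d0 dB; apply: le_trans (sqr_mass_le_tubes _ w0 prB d0 dB) _.
rewrite ler_wpM2l ?exprn_ge0 ?divr_ge0 ?(ltW d0) //; first lra.
rewrite big_mkcond /=; apply: ler_sum => t _.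
case: ifPn => [/forallP tclose|_]; last first.
  by rewrite mulr_ge0 // sumr_ge0 // => u _; rewrite mulr_ge0.
rewrite ler_wpM2l // big_mkcond [leRHS]big_mkcond /=; apply: ler_sum => u _.
have := tclose u; case: [forall i, _] => /= [->|_]; first by rewrite mulr1.
by case: ifP; rewrite ?mulr0.
Qed.

(* [pr1 g] and [pr2 g] are the projections along [V_g] and its orthogonal
   complement; [G1 g] and [G2 g] are the points whose slab stays close to them. *)
Lemma discrete_mass_le (R : realType) (n m N k : nat) (T : finType)
    (X : T -> 'rV[R]_n) (w : T -> R) (D q : R) :
  (0 < m)%N -> (n <= m + m)%N -> (k <= N)%N -> 1 <= D ->
  (forall t, `|X t| <= D) -> (forall t, 0 <= w t) ->
  0 <= q -> 2 ^+ m * q < 1 ->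
  (forall t j, (k <= j <= N)%N ->
    \sum_(u | `|X u - X t| <= 2^-1 ^+ j) w u <= q ^+ j) ->
  (forall t u v, 2^-1 ^+ k <= `|X u - X t| -> 2^-1 ^+ k <= `|X v - X t| ->
    2 * (m%:R * (2 * D * 2^-1 ^+ N)) < `|dotp (X u - X t) (X v - X t)|) ->
  \sum_t w t <= 4 * (3 * (m.+1%:R * D)) ^+ m * (2 * (6 * m%:R)) ^+ m
    * (2 ^+ m * q) ^+ k / (1 - 2 ^+ m * q).
Proof.
move=> m0 nm kN D1 XD w0 q0 Q1 wq gap.
set delta : R := 2^-1 ^+ N in gap *.
have d0 : 0 < delta by rewrite exprn_gt0.
have d1 : delta <= 1 by rewrite exprn_ile1 //; lra.
have m1 : 1 <= m%:R :> R by rewrite ler1n.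
(* Grid fine enough for [card_grid_slope]: differences of points have coordinates at most
   [2 * D]. *)
pose K := (Num.truncn (2 * D / delta)).+1.
have KD : 2 * D <= K%:R * delta.
  rewrite -ler_pdivrMr //; apply/ltW.
  have D0 : 0 <= 2 * D / delta by rewrite divr_ge0 ?(ltW d0) //; lra.
  by have /andP[] := truncn_itv D0.
pose B := m.+1%:R * D; set C : R := 6 * m%:R.
have B0 : delta <= B by rewrite /B -natr1; nra.
pose lo t : 'I_m -> R := lower (X t); pose up t : 'I_m -> R := upper (X t).
have loD t i : `|lo t i| <= D by apply: le_trans (padded_le_norm _ _) (XD t).
have upD t i : `|up t i| <= D by apply: le_trans (padded_le_norm _ _) (XD t).
pose pr1 (g : grid m K) t := slope g (lo t) (up t).
pose pr2 (g : grid m K) t := slope (grid_tr g) (fun l => - up t l) (lo t).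
have slopeB (g : grid m K) (a b : 'I_m -> R) i :
    (forall l, `|a l| <= D) -> (forall l, `|b l| <= D) -> `|slope g a b i| <= B.
  move=> aD bD; apply: le_trans (ler_normB _ _) _.
  have := slope_sum_le g i aD; have := bD i.
  by rewrite /B -natr1 mulrDl mul1r; lra.
have pr1B g t i : `|pr1 g t i| <= B by exact: slopeB.
have pr2B g t i : `|pr2 g t i| <= B by apply: slopeB => // l; rewrite normrN.
pose near1 g t u := [forall i, `|pr1 g u i - pr1 g t i| <= delta].
pose near2 g t u := [forall i, `|pr2 g u i - pr2 g t i| <= delta].
pose close t u := `|X u - X t| <= 2^-1 ^+ k.
pose G1 g t := [forall u, near1 g t u ==> close t u].
pose G2 g t := [forall u, near2 g t u ==> close t u].
pose dlo t u (i : 'I_m) : R := lower (X u - X t) i.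
pose dup t u (i : 'I_m) : R := upper (X u - X t) i.
have near1E g t u : near1 g t u = [forall i, `|slope g (dlo t u) (dup t u) i| <= delta].
  apply: eq_forallb => i; rewrite -slope_sub; congr (`|slope _ _ _ _| <= _);
  by apply/funext => l; rewrite /dlo /dup /lower /upper paddedB.
have near2E g t u : near2 g t u =
    [forall i, `|slope (grid_tr g) (fun l => - dup t u l) (dlo t u) i| <= delta].
  apply: eq_forallb => i; rewrite -slope_sub; congr (`|slope _ _ _ _| <= _);
  apply/funext => l; rewrite /dlo /dup /lower /upper paddedB //.
  by rewrite opprB opprK addrC.
have XXD t u : `|X u - X t| <= 2 * D.
  apply: le_trans (ler_normB _ _) _; have := XD t; have := XD u; lra.
have dloD t u i : `|dlo t u i| <= 2 * D.
  exact: le_trans (padded_le_norm _ _) (XXD t u).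
have dupD t u i : `|dup t u i| <= 2 * D.
  exact: le_trans (padded_le_norm _ _) (XXD t u).
(* Otherwise a far [u] near V_g and a far [v] near the orthogonal plane would give a dot product
   below the gap. *)
have G12 g t : G1 g t || G2 g t.
  apply: contraT; rewrite negb_or => /andP[/forallPn[u]].
  rewrite negb_imply near1E -ltNge => /andP[/forallP n1 /ltW cu] /forallPn[v].
  rewrite negb_imply near2E -ltNge => /andP[/forallP n2 /ltW cv].
  have := gap t u v cu cv; rewrite (dotp_halves _ _ nm) ltNge.
  by rewrite (dot_slope_le (dloD t u) (dupD t v) n1 n2).
set W := \sum_t w t.
pose F g t u : R := (near1 g t u)%:R + (near2 g t u)%:R.
(* [W <= x + y] for the masses of the two classes, hence [W^2 <= 2 (x^2 + y^2)]. *)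
have step g : W ^+ 2 <= 2 * ((3 * B / delta) ^+ m *
    \sum_t w t * \sum_(u | close t u) w u * F g t u).
  have WG : W <= \sum_(t | G1 g t) w t + \sum_(t | G2 g t) w t.
    rewrite [X in _ <= X + _]big_mkcond [X in _ <= _ + X]big_mkcond -big_split /=.
    apply: ler_sum => t _; have := G12 g t.
    by case: (G1 g t); case: (G2 g t) => //= _; rewrite ?addr0 ?add0r // lerDl.
  have W0 : 0 <= W by rewrite sumr_ge0.
  have s1 := sqr_narrow_mass_le close w0 (pr1B g) d0 B0.
  have s2 := sqr_narrow_mass_le close w0 (pr2B g) d0 B0.
  have -> : \sum_t w t * \sum_(u | close t u) w u * F g t u =
     \sum_t w t * (\sum_(u | close t u) w u * (near1 g t u)%:R) +
     \sum_t w t * (\sum_(u | close t u) w u * (near2 g t u)%:R).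
    rewrite -big_split /=; apply: eq_bigr => t _; rewrite -mulrDr -big_split /=.
    by congr (_ * _); apply: eq_bigr => u _; rewrite -mulrDr.
  rewrite mulrDr; apply: le_trans (ler_wpM2l _ (lerD s1 s2)) => //.
  move: WG; rewrite -/(G1 g _) -/(G2 g _).
  set x := \sum_(t | _) w t; set y := \sum_(t | _) w t => Wxy.
  have : W ^+ 2 <= (x + y) ^+ 2 by rewrite lerXn2r ?nnegrE // (le_trans W0).
  by have := sqr_ge0 (x - y); rewrite !expr2; lra.
pose cG : R := #|{: grid m K}|%:R.
have cG0 : 0 < cG by rewrite ltr0n; apply/card_gt0P; exists [ffun=> [ffun=> ord0]].
pose N1 t u : R := #|[pred g | near1 g t u]|%:R.
pose N2 t u : R := #|[pred g | near2 g t u]|%:R.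
(* Mean of the probabilities, over a random [g], that [u] lies in either slab of [t]. *)
pose p t u : R := (N1 t u + N2 t u) / (2 * cG).
have sumF t u : \sum_g F g t u = 2 * cG * p t u.
  rewrite /p mulrC divfK ?mulf_neq0 ?gt_eqF // big_split /= -!natr_sum.
  by congr (_%:R + _%:R); rewrite -sum1_card [RHS]big_mkcond.
have p01 t u : 0 <= p t u <= 1.
  rewrite divr_ge0 ?addr_ge0 ?mulr_ge0 ?(ltW cG0) //=.
  rewrite ler_pdivrMr ?mulr_gt0 // mul1r mulrDl mul1r.
  by apply: lerD; rewrite ler_nat max_card.
have pC t u rho : 0 < rho -> rho <= `|X u - X t| -> p t u <= (C * delta / rho) ^+ m.
  move=> r0 rX; rewrite ler_pdivrMr ?mulr_gt0 // mulrCA mulrDl mul1r.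
  have [i0 i0P] := norm_le_halves nm r0 rX.
  apply: lerD; rewrite /N1 /N2.
    rewrite (eq_card (fun g => near1E g t u)).
    apply: card_grid_slope => //; last by exists i0.
    by move=> l; exact: le_trans (dloD t u l) KD.
  (* Transposition permutes the grid, so the second slab is counted like the first with the halves
     exchanged. *)
  rewrite (eq_card (fun g => near2E g t u)) (card_grid_tr (fun g => [forall i,
    `|slope g (fun l => - dup t u l) (dlo t u) i| <= delta])).
  apply: card_grid_slope => //.
    by move=> l; rewrite normrN; exact: le_trans (dupD t u l) KD.
  by exists i0; rewrite normrN; case: i0P; [right|left].
set Q := 2 ^+ m * q in Q1 *.
pose E := delta ^+ m * (2 * C) ^+ m * Q ^+ k / (1 - Q).
have energy t : \sum_(u | close t u) w u * p t u <= E.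
  apply: (@kernel_sum_le _ _ w (p t) (fun u => `|X u - X t|) m N k q C) => //.
  - by rewrite /C; lra.
  - by move=> j; exact: wq.
  - by move=> u rho; exact: pC.
(* Sum [step] over all [g], move that sum innermost, and apply [energy] at each [t]. *)
have total : cG * W ^+ 2 <= cG * (4 * ((3 * B / delta) ^+ m * (W * E))).
  rewrite {1}/cG mulr_natl -sumr_const.
  apply: le_trans (ler_sum _ (fun g _ => step g)) _.
  rewrite -mulr_sumr -mulr_sumr exchange_big /=.
  under eq_bigr do rewrite -mulr_sumr exchange_big /=.
  under eq_bigr => t _ do under eq_bigr do rewrite -mulr_sumr sumF mulrCA.
  under eq_bigr do rewrite -mulr_sumr mulrCA.
  rewrite -mulr_sumr.
  apply: le_trans (_ : 2 * ((3 * B / delta) ^+ m * (2 * cG * (W * E))) <= _).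
    rewrite ler_wpM2l // ler_wpM2l ?exprn_ge0 ?divr_ge0 ?(ltW d0) //; first by lra.
    rewrite ler_wpM2l ?mulr_ge0 ?(ltW cG0) // mulr_suml.
    by apply: ler_sum => t _; rewrite ler_wpM2l.
  by rewrite le_eqVlt; apply/orP; left; apply/eqP; ring.
have W0 : 0 <= W by rewrite sumr_ge0.
(* The powers of [delta] cancel, which makes the bound independent of [N]. *)
have -> : 4 * (3 * B) ^+ m * (2 * C) ^+ m * Q ^+ k / (1 - Q) =
    4 * ((3 * B / delta) ^+ m * E).
  have dm0 : delta ^+ m != 0 by rewrite expf_neq0 ?gt_eqF.
  have Q0 : 1 - Q != 0 by rewrite subr_eq0 gt_eqF.
  rewrite /E expr_div_n; move: ((3 * B) ^+ m) ((2 * C) ^+ m) (Q ^+ k) => x y z.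
  by move: (delta ^+ m) (1 - Q) dm0 Q0 => d e d_neq0 e_neq0; field; apply/andP.
move: W0; rewrite le_eqVlt => /orP[/eqP <-|W0].
  rewrite !mulr_ge0 ?exprn_ge0 ?divr_ge0 ?mulr_ge0 ?exprn_ge0 ?invr_ge0 ?(ltW d0) //;
    rewrite ?subr_ge0 ?(ltW Q1) //; lra.
rewrite -(ler_pM2r W0) -expr2 -(ler_pM2l cG0); apply: le_trans total _.
by rewrite le_eqVlt; apply/orP; left; apply/eqP; ring.
Qed.

(** * Choice of scales and the dimension bound *)

Lemma two_expr_half_powR_lt1 (R : realType) (m : nat) (s : R) :
  m%:R < s -> 2 ^+ m * 2^-1 `^ s < 1.
Proof.
move=> ms; have h0 : 0 < 2^-1 :> R by [].
have -> : s = m%:R + (s - m%:R) by rewrite addrC subrK.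
rewrite powRD ?(gt_eqF h0) ?implybT // powR_mulrn ?(ltW h0) // mulrA -exprMn.
rewrite divff // expr1n mul1r /powR (gt_eqF h0) expR_lt1.
by rewrite nmulr_llt0 ?subr_gt0 // ln_lt0 // h0 /=; lra.
Qed.

(** The order of choices is essential: first [J] and [c], then [k] with the mass bound below [c],
    then [eta] for the distance 2^-k, and finally [N] with slabs too thin for [eta]. *)
Lemma hausdorff_measure_no_right_angle (R : realType) (n m : nat) (s : R)
    (A : set 'rV[R]_n) :
  (0 < m)%N -> (n <= m + m)%N -> m%:R < s -> compact A ->
  (forall x y z, A x -> A y -> A z -> y <> x -> z <> x ->
    dotp (y - x) (z - x) <> 0) ->
  hausdorff_measure s A = 0%E.
Proof.
move=> m0 nm ms cA nA; apply: contrapT => HA.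
have s0 : 0 <= s by apply: le_trans (ltW ms).
have [J [c [c0 frostman]]] := discrete_frostman cA s0 HA.
have [D D1 AD] := compact_norm_bound cA.
set q := 2^-1 `^ s in frostman.
have q0 : 0 <= q by exact: powR_ge0.
have Q1 : 2 ^+ m * q < 1 by exact: two_expr_half_powR_lt1.
pose M := 4 * (3 * (m.+1%:R * D)) ^+ m * (2 * (6 * m%:R)) ^+ m / (1 - 2 ^+ m * q).
have [k1 _ small] : \forall k \near \oo, M * (2 ^+ m * q) ^+ k < c.
  have : (geometric M (2 ^+ m * q) k @[k --> \oo] --> (0 : R)).
    by apply: cvg_geometric; rewrite ger0_norm // mulr_ge0 // exprn_ge0.
  by move=> /cvgr_lt; apply.
pose k := maxn J k1.
have r0 : 0 < 2^-1 ^+ k :> R by rewrite exprn_gt0.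
have [eta eta0 gap] := right_angle_gap cA r0 nA.
pose E : R := 2 * (m%:R * (2 * D)).
have [N1 _ tiny] : \forall j \near \oo, E * 2^-1 ^+ j < eta.
  have : (geometric E 2^-1 j @[j --> \oo] --> (0 : R)).
    by apply: cvg_geometric; rewrite gtr0_norm //; lra.
  by move=> /cvgr_lt; apply.
pose N := maxn k N1.
have kN : (k <= N)%N by exact: leq_maxl.
have Jk : (J <= k)%N by exact: leq_maxl.
have [T [X [w [AX w0 wq cW]]]] := frostman N (leq_trans Jk kN).
have : \sum_t w t < c; last by rewrite ltNge cW.
apply: le_lt_trans (small k (leq_maxr _ _)).
apply: le_trans (@discrete_mass_le _ _ m N k _ X w D q m0 nm kN D1 _ w0 q0 Q1 _ _) _.
- by move=> t; exact: AD.
- by move=> t j /andP[kj jN]; apply: wq; rewrite (leq_trans Jk kj).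
- move=> t u v tu tv; apply: lt_le_trans (gap _ _ _ (AX t) (AX u) (AX v) tu tv).
  by have := tiny N (leq_maxr _ _); rewrite /E -!mulrA.
- by rewrite /M mulrAC.
Qed.

Lemma Cangle_right_le (R : realType) (n m : nat) :
  (0 < m)%N -> (n <= m + m)%N -> (Cangle n (pi / 2 : R) <= m%:R%:E)%E.
Proof.
move=> m0 nm; apply: ge_ereal_sup => _ [A [cA <- nA]].
apply/lee_addgt0Pr => e e0; apply: ereal_inf_lbound.
exists (m%:R + e); split=> //; first by rewrite addr_ge0 // ltW.
apply: (hausdorff_measure_no_right_angle m0 nm) => //; first by rewrite ltrDl.
move=> x y z Ax Ay Az yx zx xyz; apply: nA; exists x, y, z.
split=> //; split; last by rewrite /vangle xyz mul0r acos0.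
(* Distinctness of [y] and [z] is automatic: if they agreed, the dot product would be a positive sum
   of squares. *)
split; [exact/nesym|exact/nesym|move=> yz; apply: yx].
apply/subr0_eq/eqP; rewrite -[_ == _]negbK; apply/negP => yx0.
move: xyz; rewrite -yz => /eqP; apply/negP; rewrite gt_eqF //.
have [i yi] : exists i, (y - x) ord0 i != 0.
  by apply/existsP; apply: contraR yx0 => /existsPn yx0;
     apply/eqP/rowP => i; rewrite [RHS]mxE; apply/eqP; have := yx0 i; rewrite negbK.
rewrite /dotp (bigD1 i) //= ltr_wpDr //; last by rewrite -expr2 exprn_even_gt0.
by apply: sumr_ge0 => j _; rewrite -expr2 sqr_ge0.
Qed.

Theorem theorem2p4 (R : realType) (n : nat) (hn : (2 <= n)%N) :
  (~~ odd n -> (Cangle n (pi / 2 : R) <= (n%:R / 2)%:E)%E) /\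
  (odd n -> (Cangle n (pi / 2 : R) <= ((n%:R + 1) / 2)%:E)%E).
Proof.
(* Take [m = n/2] for even [n], and [m = (n+1)/2] for odd [n], where one coordinate is padding. *)
have n2 := odd_double_half n.
split=> [/negbTE|] nodd; rewrite nodd in n2.
  have -> : n%:R / 2 = n./2%:R :> R.
    by rewrite -[in LHS]n2 -mul2n natrM mulrAC divff ?mul1r.
  apply: Cangle_right_le; first by rewrite half_gt0.
  by rewrite addnn -{1}n2.
have -> : (n%:R + 1) / 2 = n./2.+1%:R :> R.
  have -> : n%:R = 1 + 2 * n./2%:R :> R by rewrite -[in LHS]n2 -mul2n natrD natrM.
  by rewrite -[in RHS]natr1; field.
apply: Cangle_right_le => //.
by rewrite addnn doubleS -{1}n2 ltnS leqnSn.
Qed.
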